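(* Let $n\geq 2$ and let ${\cal A}$ be an arc in $R^n$. Then (i) $\rho_i({\cal A})$ is an $|{\cal A}|$-arc in $R_i^n$, and $\pi_i(\rho_i({\cal A}))$ is an $|{\cal A}|$-arc in $(R_i/M_i)^n$, for all $i\in[\ell]$; (ii) ${\cal A}$ is complete if and only if there exists some $i_0\in[\ell]$ such that $\pi_{i_0}(\rho_{i_0}({\cal A}))$ is complete.
   Context: $R$ is a finite commutative ring with identity $1\neq0$, written as $R=R_1\times\cdots\times R_\ell$ with $R_i$ finite local rings with maximal ideals $M_i$; $\rho_i:R\to R_i$ is the projection and $\pi_i:R_i\to R_i/M_i$ the natural map, both applied entrywise to vectors. For a commutative ring $S$ (here $R$, $R_i$ or the field $R_i/M_i$), a set of vectors in $S^n$ is unimodular if the matrix having them as rows has a right inverse; an $m$-subspace of $S^n$ is a submodule with a basis of $m$ vectors forming a unimodular set. Points of $S^n$ are $1$-subspaces $\langle\alpha\rangle$. A $k$-arc in $S^n$ is a set of $k$ points such that any $n$ of them span the whole space $S^n$; arcs are assumed to have size at least $n+1$. An arc is complete if it is not contained in a larger arc. For a set ${\cal S}$ of points of $R^n$, $\rho_i({\cal S})=\{\langle\rho_i(\alpha)\rangle:\langle\alpha\rangle\in{\cal S}\}$ and $\pi_i(\rho_i({\cal S}))=\{\langle\pi_i(\rho_i(\alpha))\rangle:\langle\alpha\rangle\in{\cal S}\}$. *)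

(* Defs.v *)
From HB Require Import structures.
From mathcomp Require Import all_boot all_order all_algebra.

Set Implicit Arguments.
Unset Strict Implicit.
Unset Printing Implicit Defensive.

Import GRing.Theory.
Local Open Scope ring_scope.
Local Open Scope quotient_scope.

(* A named copy of the library's quotient ring, so that it can be given the
   finite ring structure it inherits from [S]. *)
Definition quot_ring (S : comNzRingType) (I : idealr S) : Type := {ideal_quot I}.

HB.instance Definition _ (S : comNzRingType) (I : idealr S) :=
  GRing.ComNzRing.on (quot_ring I).

Section FiniteQuotient.
Variables (S : finComNzRingType) (I : idealr S).

HB.instance Definition _ : isCountable (quot_ring I) :=
  CanIsCountable (@reprK S {ideal_quot I}).
HB.instance Definition _ : isFinite (quot_ring I) :=
  CanIsFinite (@reprK S {ideal_quot I}).

End FiniteQuotient.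

Definition quot_map (S : comNzRingType) (I : idealr S) : S -> quot_ring I :=
  \pi_{ideal_quot I}.

HB.instance Definition _ (S : comNzRingType) (I : idealr S) :=
  GRing.RMorphism.copy (@quot_map S I)
    (\pi_{ideal_quot I} : {rmorphism S -> {ideal_quot I}}).

(* [idealr S] is the library type of proper ideals of [S]. *)
Definition maximal_ideal (S : comNzRingType) (I : idealr S) : Prop :=
  forall J : idealr S,
    {subset (I : {pred S}) <= (J : {pred S})} -> (J : {pred S}) =i (I : {pred S}).

Definition local_ring_with (S : comNzRingType) (M : idealr S) : Prop :=
  maximal_ideal M /\
  forall J : idealr S, maximal_ideal J -> (J : {pred S}) =i (M : {pred S}).

(* The ring morphisms [rho i] are the projections of a decomposition of [R] as
   the direct product of the rings [Rf i]. *)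
Definition product_projections (l : nat) (R : comNzRingType)
    (Rf : 'I_l -> comNzRingType) (rho : forall i, {rmorphism R -> Rf i}) : Prop :=
  forall y : (forall i, Rf i), exists! x : R, forall i, rho i x = y i.

Section Arcs.
Variables (S : finComNzRingType) (n : nat).

Definition unimodular_mx (m : nat) (B : 'M[S]_(m, n)) : Prop :=
  exists C : 'M[S]_(n, m), B *m C = 1%:M.

Definition lin_indep (m : nat) (B : 'M[S]_(m, n)) : Prop :=
  forall c : 'rV[S]_m, c *m B = 0 -> c = 0.

Definition rspan (X : {set 'rV[S]_n}) : {set 'rV[S]_n} :=
  [set v | [exists c : {ffun 'rV[S]_n -> S}, v == \sum_(x in X) c x *: x]].

Definition is_subspace (m : nat) (U : {set 'rV[S]_n}) : Prop :=
  exists B : 'M[S]_(m, n),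
    [/\ unimodular_mx B, lin_indep B & U = rspan [set row i B | i : 'I_m]].

Definition is_point (U : {set 'rV[S]_n}) : Prop := is_subspace 1 U.

Definition is_karc (k : nat) (A : {set {set 'rV[S]_n}}) : Prop :=
  [/\ forall U, U \in A -> is_point U,
      #|A| = k,
      (n.+1 <= k)%N
    & forall B : {set {set 'rV[S]_n}},
        B \subset A -> #|B| = n -> rspan (cover B) = [set: 'rV[S]_n]].

Definition is_arc (A : {set {set 'rV[S]_n}}) : Prop := exists k, is_karc k A.

Definition is_complete_arc (A : {set {set 'rV[S]_n}}) : Prop :=
  is_arc A /\ ~ exists A' : {set {set 'rV[S]_n}}, is_arc A' /\ A \proper A'.

End Arcs.

Definition map_points (S T : finComNzRingType) (n : nat) (f : S -> T)
    (A : {set {set 'rV[S]_n}}) : {set {set 'rV[T]_n}} :=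
  [set rspan [set map_mx f a] | a : 'rV[S]_n & rspan [set a] \in A].

(* Main.v *)
Require Import Defs.
From HB Require Import structures.
From mathcomp Require Import all_boot all_order all_algebra.
From Stdlib Require Import Classical.

Set Implicit Arguments.
Unset Strict Implicit.
Unset Printing Implicit Defensive.

Import GRing.Theory.
Local Open Scope ring_scope.

(** A set of more than [n] points is an arc iff, for every choice of [n] vectors
    generating distinct points of the set, the determinant of these vectors is
    invertible. A ring morphism preserves invertibility of determinants, so it
    sends arcs to arcs; it is injective on the points of an arc because two
    proportional rows never occur in an invertible matrix over a nontrivial
    ring. This gives (i), and shows that an extension of the arc extends all its
    residual images. Conversely, if each residual image can be extended by a
    point [b_i], the Chinese-remainder lift [a] of the [b_i] extends the arc,
    since an element of a finite product of local rings is invertible as soon as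
    all its residues are. *)

(** * Invertible elements and determinants *)

Definition invertible (S : comNzRingType) (x : S) : Prop :=
  exists y, x * y = 1.

Notation pt a := (rspan [set a]).

Lemma invertible_mull (S : comNzRingType) (x y : S) :
  invertible (x * y) -> invertible y.
Proof. by case=> z xyz1; exists (x * z); rewrite mulrCA mulrA. Qed.

Lemma invertible_rmorph (S T : comNzRingType) (f : {rmorphism S -> T}) (x : S) :
  invertible x -> invertible (f x).
Proof. by case=> y xy1; exists (f y); rewrite -rmorphM xy1 rmorph1. Qed.

Lemma invertible_det_lin_indep (S : finComNzRingType) n (E : 'M[S]_n) :
  invertible (\det E) -> lin_indep E.
Proof.
case=> u Eu c cE0; have := congr1 (mulmx^~ (u *: \adj E)) cE0.
by rewrite mul0mx -mulmxA -scalemxAr mul_mx_adj scale_scalar_mx mulrC Eu mulmx1.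
Qed.

(** Used to place two given points of an arc among [n] distinct ones, hence in one square matrix of
    generators. *)
Lemma exists_injective_pair (T : finType) (A : {set T}) n (x y : T) :
  x \in A -> y \in A -> x != y -> (2 <= n)%N -> (n <= #|A|)%N ->
  exists g : 'I_n -> T, [/\ injective g, forall i, g i \in A
    & exists i j, [/\ i != j, g i = x & g j = y]].
Proof.
case: n => [|[|n]] // xA yA nxy _ leA.
(* Listing [A] with [x] and [y] in front puts them at positions 0 and 1; [g] reads off an initial
   segment. *)
pose s := x :: y :: enum (A :\ x :\ y).
have us : uniq s.
  by rewrite /= inE !mem_enum !inE !eqxx enum_uniq negb_or nxy !andbF.
have sA z : z \in s -> z \in A.
  rewrite !inE mem_enum !inE => /or3P[/eqP->|/eqP->|/and3P[]] //.
have szs : size s = #|A|.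
  rewrite /= -cardE (cardsD1 x A) xA (cardsD1 y (A :\ x)) !inE yA.
  by rewrite eq_sym nxy.
have lts (i : 'I_n.+2) : (i < size s)%N by rewrite szs (leq_trans (ltn_ord i)).
exists (fun i => nth x s i); split.
- by move=> i j /eqP; rewrite nth_uniq // => /eqP/val_inj.
- by move=> i; rewrite sA ?mem_nth.
- by exists ord0, (lift ord0 ord0); split.
Qed.

(** * Spans, points and the determinant criterion for arcs *)

Section Span.
Variables (S : finComNzRingType) (n : nat).
Implicit Types (X : {set 'rV[S]_n}) (a b v : 'rV[S]_n).

Lemma rspanP X v :
  reflect (exists c : 'rV[S]_n -> S, v = \sum_(x in X) c x *: x) (v \in rspan X).
Proof.
rewrite inE; apply: (iffP existsP) => [[c /eqP->]|[c ->]]; first by exists c.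
by exists (finfun c); apply/eqP/eq_bigr => x _; rewrite ffunE.
Qed.

Lemma mem_rspan X v : v \in X -> v \in rspan X.
Proof.
move=> vX; apply/rspanP; exists (fun x => (x == v)%:R).
rewrite (bigD1 v) //= eqxx scale1r big1 ?addr0 // => x /andP[_ /negPf->].
by rewrite scale0r.
Qed.

Lemma rspanD X v w : v \in rspan X -> w \in rspan X -> v + w \in rspan X.
Proof.
move=> /rspanP[c ->] /rspanP[d ->]; apply/rspanP; exists (fun x => c x + d x).
by rewrite -big_split; apply: eq_bigr => x _; rewrite scalerDl.
Qed.

Lemma rspanZ X k v : v \in rspan X -> k *: v \in rspan X.
Proof.
move=> /rspanP[c ->]; apply/rspanP; exists (fun x => k * c x).
by rewrite scaler_sumr; apply: eq_bigr => x _; rewrite scalerA.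
Qed.

Lemma rspan_lincomb X m (E : 'M[S]_(m, n)) (c : 'rV_m) :
  (forall i, row i E \in rspan X) -> c *m E \in rspan X.
Proof.
move=> EX; rewrite mulmx_sum_row; elim/big_ind: _ => [|v w|i _].
- by apply/rspanP; exists (fun=> 0); rewrite big1 // => x; rewrite scale0r.
- exact: rspanD.
- exact: rspanZ.
Qed.

Lemma rspan_row_space X m (E : 'M[S]_(m, n)) v :
  (forall x, x \in X -> exists c : 'rV_m, x = c *m E) ->
  v \in rspan X -> exists c : 'rV_m, v = c *m E.
Proof.
move=> XE /rspanP[d ->]; elim/big_ind: _ => [|_ _ [c ->] [c' ->]|x xX].
- by exists 0; rewrite mul0mx.
- by exists (c + c'); rewrite mulmxDl.
- by have [c xc] := XE x xX; exists (d x *: c); rewrite -scalemxAl -xc.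
Qed.

Lemma mem_ptP a v : reflect (exists k, v = k *: a) (v \in pt a).
Proof.
apply: (iffP (rspanP _ _)) => [[c]|[k ->]].
  by rewrite big_set1 => ->; exists (c a).
by exists (fun=> k); rewrite big_set1.
Qed.

Lemma mem_pt a : a \in pt a.
Proof. by rewrite mem_rspan ?set11. Qed.

Lemma sub_pt a b : a \in pt b -> pt a \subset pt b.
Proof.
move=> /mem_ptP[k ->]; apply/subsetP => v /mem_ptP[m ->].
by rewrite !rspanZ ?mem_pt.
Qed.

Lemma is_pointP (U : {set 'rV[S]_n}) :
  is_point U <-> exists a, unimodular_mx a /\ U = pt a.
Proof.
have row1 a : [set row i a | i : 'I_1] = [set a].
  apply/setP => v; rewrite inE; apply/imsetP/eqP => [[i _ ->]|->].
    by rewrite ord1 row_id.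
  by exists 0; rewrite ?row_id.
split=> [[a [ua _ ->]]|[a [ua ->]]]; exists a; first by rewrite row1.
(* A right inverse [C] of [a] gives [c = c *m a *m C], whence linear independence. *)
split; rewrite ?row1 // => c ca0; have [C aC] := ua.
by rewrite -[c]mulmx1 -aC mulmxA ca0 mul0mx.
Qed.

Lemma unimodular_mem_pt a b :
  b \in pt a -> unimodular_mx b -> unimodular_mx a.
Proof.
move=> /mem_ptP[k ->] [C kaC]; exists (k *: C).
by rewrite -scalemxAr scalemxAl.
Qed.

Lemma is_point_pt a : is_point (pt a) <-> unimodular_mx a.
Proof.
split=> [/is_pointP[b [ub eq_ab]]|ua]; last by apply/is_pointP; exists a.
by apply: unimodular_mem_pt ub; rewrite eq_ab mem_pt.
Qed.

(** The coefficients expressing the unit vectors form a left inverse of [E], so [\det E] divides 1;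
    conversely, Cramer's formula with the adjugate solves [v = c *m E]. *)
Lemma row_space_full (E : 'M[S]_n) :
  (forall v : 'rV_n, exists c : 'rV_n, v = c *m E) <-> invertible (\det E).
Proof.
split=> [fullE|[u Eu] v]; last first.
  exists (u *: v *m \adj E).
  rewrite -mulmxA mul_adj_mx mul_mx_scalar scalerA.
  by rewrite Eu scale1r.
have [C CE] := fin_all_exists (fun j => fullE (delta_mx 0 j)).
apply: (@invertible_mull _ (\det (\matrix_j C j))); exists 1.
rewrite mulr1 -det_mulmx -[RHS](det1 S n); congr (\det _).
by apply/row_matrixP => j; rewrite row_mul rowK -CE row1.
Qed.

(** Allows a change of generators: each row [e i] is a multiple of [e' i], so the row space can only
    grow. *)
Lemma invertible_det_mem_pt (e e' : 'I_n -> 'rV[S]_n) :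
  (forall i, e i \in pt (e' i)) ->
  invertible (\det (\matrix_i e i)) -> invertible (\det (\matrix_i e' i)).
Proof.
move=> ee' /row_space_full fulle; apply/row_space_full => v.
have [c ->] := fulle v.
have [k ke] := fin_all_exists (fun i => mem_ptP _ _ (ee' i)).
exists (c *m diag_mx (\row_i k i)); rewrite -mulmxA; congr (_ *m _).
by apply/row_matrixP => i; rewrite row_mul row_diag_mx -scalemxAl -rowE !rowK mxE ke.
Qed.

(** The union of [n] points and a choice of one generator for each span the same module, and
    [row_space_full] turns spanning into a determinant condition. *)
Lemma is_arcP (A : {set {set 'rV[S]_n}}) :
  is_arc A <->
  [/\ forall U, U \in A -> is_point U, (n < #|A|)%N
    & forall e : 'I_n -> 'rV[S]_n, (forall i, pt (e i) \in A) ->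
        injective (fun i => pt (e i)) -> invertible (\det (\matrix_i e i))].
Proof.
split=> [[_ [ptA <- ltA spanA]]|[ptA ltA detA]].
  split=> // e eA inj_e; apply/row_space_full => v.
  have spanE : rspan (cover [set pt (e i) | i : 'I_n]) = [set: 'rV_n].
    apply: spanA; first by apply/subsetP => _ /imsetP[i _ ->].
    by rewrite card_imset // card_ord.
  have : v \in rspan (cover [set pt (e i) | i : 'I_n]) by rewrite spanE inE.
  apply: rspan_row_space => x /bigcupP[_ /imsetP[i _ ->] /mem_ptP[k ->]].
  by exists (k *: delta_mx 0 i); rewrite -scalemxAl -rowE rowK.
exists #|A|; split=> // B sBA cardB; apply/setP => v; rewrite !inE.
pose g (i : 'I_n) := enum_val (cast_ord (esym cardB) i).
have gB i : g i \in B by apply: enum_valP.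
have inj_g : injective g by move=> i j /enum_val_inj/cast_ord_inj.
have ge i : exists a, pt a = g i.
  by have /is_pointP[a [_ ->]] := ptA _ (subsetP sBA _ (gB i)); exists a.
have {ge}[e eg] := fin_all_exists ge.
have /row_space_full/(_ v)[c ->] : invertible (\det (\matrix_i e i)).
  apply: detA => [i|i j]; first by rewrite eg (subsetP sBA).
  by rewrite !eg => /inj_g.
have := @rspan_lincomb (cover B) _ (\matrix_i e i) c; rewrite inE; apply=> i.
by rewrite rowK mem_rspan //; apply/bigcupP; exists (g i); rewrite // -eg mem_pt.
Qed.

End Span.

(** * Images of arcs under a ring morphism *)

Section ArcImage.
Variables (S T : finComNzRingType) (f : {rmorphism S -> T}) (n : nat).
Implicit Types (a b : 'rV[S]_n) (A : {set {set 'rV[S]_n}}).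

Lemma mem_map_points A (U : {set 'rV[T]_n}) :
  reflect (exists2 a, pt a \in A & U = pt (map_mx f a)) (U \in map_points f A).
Proof.
by apply: (iffP imsetP) => [[a]|[a aA ->]]; [rewrite inE | ]; exists a; rewrite ?inE.
Qed.

Lemma map_points_mono A A' :
  A \subset A' -> map_points f A \subset map_points f A'.
Proof.
move=> sAA'; apply/subsetP => _ /mem_map_points[a aA ->].
by apply/mem_map_points; exists a; rewrite ?(subsetP sAA').
Qed.

Lemma unimodular_map_mx a : unimodular_mx a -> unimodular_mx (map_mx f a).
Proof.
by case=> C aC; exists (map_mx f C); rewrite -map_mxM aC map_mx1.
Qed.

Lemma pt_map_mx a b : pt a = pt b -> pt (map_mx f a) = pt (map_mx f b).
Proof.
have sub c d : pt c = pt d -> pt (map_mx f c) \subset pt (map_mx f d).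
  move=> cd; apply: sub_pt; have /mem_ptP[k ->] : c \in pt d by rewrite -cd mem_pt.
  by rewrite map_mxZ rspanZ ?mem_pt.
by move=> ab; apply/eqP; rewrite eqEsubset !sub.
Qed.

Lemma map_det_rows (e : 'I_n -> 'rV[S]_n) :
  f (\det (\matrix_i e i)) = \det (\matrix_i map_mx f (e i)).
Proof.
rewrite -det_map_mx; congr (\det _).
by apply/row_matrixP => i; rewrite -map_row !rowK.
Qed.

Hypothesis n_ge2 : (2 <= n)%N.

Lemma arc_pt_map_inj A a b : is_arc A -> pt a \in A -> pt b \in A ->
  pt (map_mx f a) = pt (map_mx f b) -> pt a = pt b.
Proof.
move=> /is_arcP[ptA ltA detA] aA bA fab; apply/eqP/negPn/negP => nab.
have [g [inj_g gA [i [j [nij gi gj]]]]] :=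
  exists_injective_pair aA bA nab n_ge2 (ltnW ltA).
have ge k : exists c, pt c = g k.
  by have /is_pointP[c [_ ->]] := ptA _ (gA k); exists c.
have {ge}[e eg] := fin_all_exists ge.
have : invertible (f (\det (\matrix_k e k))).
  apply: invertible_rmorph; apply: detA => [k|k m]; first by rewrite eg.
  by rewrite !eg => /inj_g.
rewrite map_det_rows => /invertible_det_lin_indep indep.
(* [e i] and [a] generate the same point but may differ, and likewise [e j] and [b]. *)
have fij : pt (map_mx f (e i)) = pt (map_mx f (e j)).
  rewrite (@pt_map_mx (e i) a) ?(@pt_map_mx (e j) b) ?fab //.
    by rewrite eg gj.
  by rewrite eg gi.
have /mem_ptP[c feij] : map_mx f (e i) \in pt (map_mx f (e j)).
  by rewrite -fij mem_pt.
(* This combination of the image rows vanishes, yet its coefficient at [i] is 1. *)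
have := indep (delta_mx 0 i - c *: delta_mx 0 j).
rewrite mulmxBl -scalemxAl -!rowE !rowK feij subrr => /(_ erefl)/rowP/(_ i).
rewrite !mxE !eqxx (negPf nij) mulr0 subr0 => /eqP.
by rewrite oner_eq0.
Qed.

Lemma card_map_points A : is_arc A -> #|map_points f A| = #|A|.
Proof.
move=> arcA; have [ptA _ _] := (is_arcP A).1 arcA.
(* A chosen generator; the default 0 is never returned on members of [A]. *)
pose gen (U : {set 'rV[S]_n}) := odflt 0 [pick a | pt a == U].
have genK U : U \in A -> pt (gen U) = U.
  move=> /ptA/is_pointP[a [_ Ua]]; rewrite /gen.
  by case: pickP => [b /eqP//|/(_ a)]; rewrite Ua eqxx.
have -> : map_points f A = [set pt (map_mx f (gen U)) | U in A].
  apply/setP => U; apply/mem_map_points/imsetP => [[a aA ->]|[V VA ->]].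
    by exists (pt a) => //; apply: pt_map_mx; rewrite genK.
  by exists (gen V); rewrite ?genK.
apply: card_in_imset => U V UA VA /(arc_pt_map_inj arcA).
by rewrite !genK // => /(_ UA VA).
Qed.

Lemma is_arc_map_points A : is_arc A -> is_arc (map_points f A).
Proof.
move=> arcA; have [ptA ltA detA] := (is_arcP A).1 arcA.
apply/is_arcP; split=> [_ /mem_map_points[a /ptA/is_point_pt ua ->]||e eA inj_e].
- exact/is_point_pt/unimodular_map_mx.
- by rewrite card_map_points.
(* The rows [e i] need not be images under [f]; each is replaced by an image vector generating the
   same point. *)
have [g gA eg] := fin_all_exists2 (fun i => mem_map_points _ _ (eA i)).
apply: (@invertible_det_mem_pt _ _ (fun i => map_mx f (g i))) => [i|].
  by rewrite eg mem_pt.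
rewrite -map_det_rows; apply: invertible_rmorph; apply: detA => // i j gij.
by apply: inj_e; rewrite /= !eg; apply: pt_map_mx.
Qed.

Lemma is_karc_map_points A : is_arc A -> is_karc #|A| (map_points f A).
Proof.
move=> arcA; have [k arck] := is_arc_map_points arcA.
by have [_ ck _ _] := arck; rewrite -(card_map_points arcA) ck.
Qed.

(** A proper extension of [A] stays proper after mapping, because [f] preserves the sizes of
    arcs. *)
Lemma complete_arc_of_map A :
  is_arc A -> is_complete_arc (map_points f A) -> is_complete_arc A.
Proof.
move=> arcA [_ maxfA]; split=> // -[A' [arcA' ltAA']]; apply: maxfA.
exists (map_points f A'); split; first exact: is_arc_map_points.
rewrite properEcard map_points_mono ?(proper_sub ltAA') //.
by rewrite !card_map_points // proper_card.
Qed.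

End ArcImage.

(** * Invertibility in a finite local ring *)

Section LocalRing.
Variable S : finComNzRingType.

(** Boolean, so that a maximal proper ideal can be obtained as a maximal subset of the finite
    ring. *)
Definition idealb (J : {set S}) : bool :=
  [&& 0 \in J, 1 \notin J
    & [forall a, forall u in J, forall v in J, a * u + v \in J]].

Lemma idealbP (J : {set S}) : reflect (idealr_closed (mem J)) (idealb J).
Proof.
apply: (iffP and3P) => -[J0 J1 JD]; split=> //.
  move=> a u v uJ vJ.
  by have /forallP/(_ a)/forall_inP/(_ u uJ)/forall_inP/(_ v vJ) := JD.
apply/forallP => a; apply/forall_inP => u uJ; apply/forall_inP => v vJ.
exact: JD.
Qed.

Lemma idealr_of_set (J : {set S}) :
  idealb J -> exists I : idealr S, (I : {pred S}) =i J.
Proof.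
move=> /idealbP Jid.
pose mix := isIdealr.Build S (fun x => x \in J) Jid.
pose I : idealr S := HB.pack (fun x => x \in J) mix.
by exists I.
Qed.

Lemma idealb_of_idealr (I : idealr S) : idealb [set x in (I : {pred S})].
Proof.
apply/idealbP; split=> [||a u v]; rewrite !inE ?rpred0 ?idealr1 // => uI vI.
by rewrite rpredD ?idealMr.
Qed.

Lemma nonunit_in_maximal (x : S) :
  ~ invertible x -> exists2 I : idealr S, maximal_ideal I & x \in (I : {pred S}).
Proof.
(* The principal ideal of [x] is proper since [x] is not invertible; it is then enlarged to a
   maximal one. *)
move=> nux; pose xS := [set y | [exists z, y == x * z]].
have xSP y : reflect (exists z, y = x * z) (y \in xS).
  by rewrite inE; apply: (iffP existsP) => -[z /eqP]; exists z.
have xSid : idealb xS.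
  apply/idealbP; split; first by apply/xSP; exists 0; rewrite mulr0.
    by apply/xSP => -[z /esym xz]; case: nux; exists z.
  move=> a u v /xSP[y ->] /xSP[z ->]; apply/xSP; exists (a * y + z).
  by rewrite mulrDr mulrCA.
have [J /maxsetP[Jid Jmax] sxJ] := maxset_exists xSid.
have [I IJ] := idealr_of_set Jid; exists I.
  move=> K sIK y; rewrite IJ -(Jmax [set z in (K : {pred S})]) ?inE //.
    exact: idealb_of_idealr.
  by apply/subsetP => z zJ; rewrite inE sIK // IJ.
by rewrite IJ (subsetP sxJ) //; apply/xSP; exists 1; rewrite mulr1.
Qed.

(** A non-invertible [x] would lie in a maximal ideal, hence in [M], and its residue 0 is not
    invertible. *)
Lemma local_invertible (M : idealr S) (x : S) :
  local_ring_with M -> invertible (@quot_map S M x) -> invertible x.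
Proof.
move=> [_ locM] [y xy1]; apply: NNPP => /nonunit_in_maximal[I /locM IM].
rewrite IM => xM.
have x0 : @quot_map S M x = 0.
  rewrite -(rmorph0 (@quot_map S M)); apply/eqP.
  by rewrite /quot_map -Quotient.idealrBE subr0.
by move/eqP: xy1; rewrite x0 mul0r eq_sym oner_eq0.
Qed.

End LocalRing.

(** * Lifting simultaneous extensions of the images of an arc *)

Section JointExtension.
Variables (l : nat) (R : finComNzRingType) (K : 'I_l -> finComNzRingType).
Variables (f : forall i, {rmorphism R -> K i}) (n : nat).
Hypothesis l_gt0 : (0 < l)%N.
Hypothesis f_surj : forall y : (forall i, K i), exists x, forall i, f i x = y i.
Hypothesis f_inv : forall x, (forall i, invertible (f i x)) -> invertible x.
Hypothesis n_ge2 : (2 <= n)%N.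

Lemma map_mx_joint_surj p q (B : forall i, 'M[K i]_(p, q)) :
  exists C : 'M[R]_(p, q), forall i, map_mx (f i) C = B i.
Proof.
have [c cB] := fin_all_exists (fun rs : 'I_p * 'I_q => f_surj (fun i => B i rs.1 rs.2)).
exists (\matrix_(r, s) c (r, s)) => i.
by apply/matrixP => r s; rewrite !mxE cB.
Qed.

Lemma joint_extension (A : {set {set 'rV[R]_n}}) : is_arc A ->
  (forall i, ~ is_complete_arc (map_points (f i) A)) -> ~ is_complete_arc A.
Proof.
move=> arcA incomplete [_ maxA]; apply: maxA.
have [ptA ltA detA] := (is_arcP A).1 arcA.
have ext i : exists b : 'rV[K i]_n, [/\ unimodular_mx b,
    pt b \notin map_points (f i) A & exists A', [/\ is_arc A', pt b \in A'
      & map_points (f i) A \subset A']].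
  have [A' [arcA' /properP[sAA' [U UA' UA]]]] :
      exists A', is_arc A' /\ map_points (f i) A \proper A'.
    apply: NNPP => nA'; apply: (incomplete i).
    by split=> //; apply: is_arc_map_points.
  have [ptA' _ _] := (is_arcP A').1 arcA'.
  have /is_pointP[b [ub Ub]] := ptA' U UA'; rewrite {}Ub in UA UA' *.
  by exists b; split=> //; exists A'.
have {ext}[b bP] := fin_all_exists ext.
have [a ab] := map_mx_joint_surj b.
have aNA i x : pt x \in A -> pt (map_mx (f i) x) <> pt (map_mx (f i) a).
  move=> xA fxa; have [_ /negP bN _] := bP i; apply: bN.
  by apply/mem_map_points; exists x; rewrite // fxa ab.
(* One index suffices to separate [a] from [A]; [l_gt0] provides it. *)
have aA : pt a \notin A by apply/negP => /(aNA (Ordinal l_gt0))[].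
(* Right inverses of the [b i] lift to [C]; the scalar [a *m C] maps to 1 under every [f i], so it
   is invertible and [C] can be rescaled. *)
have ua : unimodular_mx a.
  have inv_b i : exists c : 'cV_n, b i *m c = 1%:M by have [] := bP i.
  have [c cb] := fin_all_exists inv_b.
  have [C Cc] := map_mx_joint_surj c.
  have [|u acu] := @f_inv ((a *m C) 0 0).
    move=> i; exists 1; have /matrixP/(_ 0 0) := cb i.
    by rewrite mulr1 -ab -Cc -map_mxM !mxE.
  exists (u *: C); rewrite -scalemxAr; apply/matrixP => r s.
  by rewrite !ord1 !mxE in acu *; rewrite mulrC acu.
exists (pt a |: A); split; last by rewrite properUr // sub1set.
apply/is_arcP; split.
- by move=> U /setU1P[->|/ptA//]; apply/is_point_pt.
- by rewrite cardsU1 aA ltnW.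
move=> e eA inj_e; apply: f_inv => i; rewrite map_det_rows.
have [_ _ [A' [/is_arcP[_ _ detA'] bA' sAA']]] := bP i.
(* The images of the rows lie in the arc [A']; they stay distinct by [aNA] when one row generates
   [pt a], and by injectivity on [A] otherwise. *)
apply: detA' => [j|j k fjk].
  have /setU1P[/(pt_map_mx (f i))->|eAj] := eA j; first by rewrite ab.
  by apply: (subsetP sAA'); apply/mem_map_points; exists (e j).
apply: inj_e => /=.
have /setU1P[ej|ejA] := eA j; have /setU1P[ek|ekA] := eA k.
- by rewrite ej ek.
- by case: (aNA i _ ekA); rewrite -fjk; apply: pt_map_mx.
- by case: (aNA i _ ejA); rewrite fjk; apply: pt_map_mx.
- exact: (arc_pt_map_inj n_ge2 arcA ejA ekA fjk).
Qed.

End JointExtension.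

Theorem theorem6p1 (l : nat) (R : finComNzRingType)
    (Rf : 'I_l -> finComNzRingType) (M : forall i : 'I_l, idealr (Rf i))
    (hlocal : forall i : 'I_l, local_ring_with (M i))
    (rho : forall i : 'I_l, {rmorphism R -> Rf i})
    (hprod : product_projections rho)
    (n : nat) (hn : (2 <= n)%N)
    (A : {set {set 'rV[R]_n}}) (hA : is_arc A) :
  (forall i : 'I_l,
     is_karc #|A| (map_points (rho i) A) /\
     is_karc #|A| (map_points (@quot_map (Rf i) (M i) \o rho i) A)) /\
  (is_complete_arc A <->
   exists i0 : 'I_l,
     is_complete_arc (map_points (@quot_map (Rf i0) (M i0) \o rho i0) A)).
Proof.
pose f i : {rmorphism R -> quot_ring (M i)} := @quot_map (Rf i) (M i) \o rho i.
split=> [i|].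
  split; first exact: is_karc_map_points.
  exact: (is_karc_map_points (f i)).
split=> [compA|[i compi]]; last first.
  exact: (complete_arc_of_map (f := f i) hn hA compi).
apply: NNPP => incomplete.
apply: (@joint_extension _ _ _ f n) compA => //.
(* For [l = 0], uniqueness in the empty product would force [0 = 1] in [R]. *)
- case: (posnP l) => // l0; have [x [_ uniq_x]] := hprod (fun i => 0).
  have noI (i : 'I_l) : False by case: i => m; rewrite l0.
  have : (0 : R) = 1 by rewrite -(uniq_x 0) ?(uniq_x 1) // => i; case: (noI i).
  by move/eqP; rewrite eq_sym oner_eq0.
- move=> y; have [x [xy _]] := hprod (fun i => repr (y i : {ideal_quot (M i)})).
  by exists x => i; rewrite /f /= xy /quot_map reprK.
(* The inverses found in the local factors assemble into [z], and uniqueness of the element with all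
   projections 1 gives [x * z = 1]. *)
- move=> x invx.
  have [y xy1] :=
    fin_all_exists (fun i => local_invertible (hlocal i) (invx i)).
  have [z [zy _]] := hprod y; exists z.
  have [w [_ uniq_w]] := hprod (fun i => 1).
  by rewrite -(uniq_w (x * z)) ?(uniq_w 1) // => i; rewrite ?rmorph1 ?rmorphM ?zy ?xy1.
- by move=> i compi; apply: incomplete; exists i.
Qed.
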